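(* For $q\in\mathbb C$ with $|q|>1$ and $\Re s>1$, the Dirichlet series of $\mathfrak S(n,q)$ and $\mathfrak F(n,q)$ are given by $$\sum_{n\ge2}\frac{\mathfrak S(n,q)}{n^s}=(q-1)q\,\zeta(s)\,\bigl(\operatorname{Li}_s(1/q)-q^{-1}\bigr),$$ $$\sum_{n\ge2}\frac{\mathfrak F(n,q)}{n^s}=(q-1)q\,\bigl(\zeta(s)-1\bigr)\bigl(\operatorname{Li}_s(1/q)-q^{-1}\bigr).$$
   Context: For $z\in\mathbb C$ and an integer $i\ge2$, $F(z,i)=i+2\sum_{k=1}^{i-1}(i-k)\cos(2\pi kz/i)$. For $|q|>1$, $$\mathfrak S(z,q)=(q-1)q\sum_{i=2}^\infty\frac{F(z,i)}{i^2}\,q^{-i},\qquad \mathfrak F(z,q)=\mathfrak S(z,q)-(q-1)q\,q^{-z},$$ where $q^{-z}=e^{-z\log q}$ with the principal logarithm (branch-independent at integers $z=n$). $\zeta$ is the Riemann zeta function and $\operatorname{Li}_s(w)=\sum_{n\ge1}w^n n^{-s}$ for $|w|<1$. *)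

(* Defs.v *)
From Stdlib Require Import Reals Lra Lia.
From Coquelicot Require Import Coquelicot.
Open Scope R_scope.
Open Scope C_scope.

Definition Cexp (z : C) : C :=
  (exp (Re z) * cos (Im z), exp (Re z) * sin (Im z))%R.

Definition Ccos (z : C) : C := (Cexp (Ci * z) + Cexp (- (Ci * z))) / 2.

(* Principal argument, in (-PI, PI]; the value at 0 is irrelevant. *)
Definition Carg (z : C) : R :=
  if Rle_dec 0 (Im z) then acos (Re z / Cmod z) else Ropp (acos (Re z / Cmod z)).

Definition Clog (z : C) : C := (ln (Cmod z), Carg z).

Definition Cpower (w z : C) : C := Cexp (z * Clog w).

Definition is_Cseries_from (m : nat) (a : nat -> C) (l : C) : Prop :=
  is_series (fun k : nat => a (m + k)%nat) l.

(* Total sum of a complex series; meaningful when the series converges, see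
   [Cseries_from_unique]. *)
Definition Cseries_from (m : nat) (a : nat -> C) : C :=
  (Series (fun k : nat => Re (a (m + k)%nat)),
   Series (fun k : nat => Im (a (m + k)%nat))).

Definition fejerF (z : C) (i : nat) : C :=
  INR i + 2 * sum_n_m (fun k : nat =>
                 (INR i - INR k) * Ccos (2 * PI * INR k * z / INR i))
              1 (i - 1).

Definition frakS (z q : C) : C :=
  (q - 1) * q *
    Cseries_from 2 (fun i : nat => fejerF z i / INR i ^ 2 * / q ^ i).

Definition frakF (z q : C) : C :=
  frakS z q - (q - 1) * q * Cpower q (- z).

(* The Dirichlet series of zeta: this is the Riemann zeta function on the
   half-plane 1 < Re s, and no analytic continuation is encoded. *)
Definition zeta (s : C) : C :=
  Cseries_from 1 (fun n : nat => / Cpower (INR n) s).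

(* The polylogarithm Li_s(w), for |w| < 1. *)
Definition polylog (s w : C) : C :=
  Cseries_from 1 (fun n : nat => w ^ n * Cpower (INR n) (- s)).

Lemma filterlim_fst_snd (u : nat -> C) (l : C) :
  filterlim u eventually (locally l) ->
  is_lim_seq (fun n => Re (u n)) (Re l) /\ is_lim_seq (fun n => Im (u n)) (Im l).
Proof.
intros H; split.
- apply (filterlim_comp _ _ _ u fst eventually (locally l)); [exact H|].
  intros P [e He]; exists e; intros y Hy; apply He; apply Hy.
- apply (filterlim_comp _ _ _ u snd eventually (locally l)); [exact H|].
  intros P [e He]; exists e; intros y Hy; apply He; apply Hy.
Qed.

Lemma Re_Im_sum_n (a : nat -> C) (n : nat) :
  Re (sum_n a n) = sum_n (fun k => Re (a k)) n /\
  Im (sum_n a n) = sum_n (fun k => Im (a k)) n.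
Proof.
induction n as [|n [IHr IHi]].
- now rewrite !sum_O.
- rewrite !sum_Sn, <- IHr, <- IHi; split; reflexivity.
Qed.

Lemma Cseries_from_unique (m : nat) (a : nat -> C) (l : C) :
  is_Cseries_from m a l -> Cseries_from m a = l.
Proof.
intros H.
assert (H' : filterlim (sum_n (fun k : nat => a (m + k)%nat)) eventually
               (locally (T := C_UniformSpace) l)).
{ exact H. }
apply filterlim_fst_snd in H'; destruct H' as [Hr Hi].
rewrite (surjective_pairing l); unfold Cseries_from; f_equal;
  apply is_series_unique.
- refine (is_lim_seq_ext _ _ _ _ Hr); intros n; apply Re_Im_sum_n.
- refine (is_lim_seq_ext _ _ _ _ Hi); intros n; apply Re_Im_sum_n.
Qed.

Lemma Cexp_Clog (z : C) : z <> 0 -> Cexp (Clog z) = z.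
Proof.
intros Hz.
assert (Hm : (0 < Cmod z)%R) by now apply Cmod_gt_0.
assert (Hsq : (Re z * Re z + Im z * Im z = Cmod z * Cmod z)%R).
{ generalize (Cmod2_alt z); intros E; simpl in E; lra. }
assert (Hb : (-1 <= Re z / Cmod z <= 1)%R).
{ generalize (re_le_Cmod z); intros E.
  apply Rabs_le_between in E.
  split; [apply Rle_div_r | apply Rle_div_l]; lra. }
assert (Hs : sqrt (1 - (Re z / Cmod z)²) = (Rabs (Im z) / Cmod z)%R).
{ replace (1 - (Re z / Cmod z)²)%R with ((Im z / Cmod z)²)%R.
  - rewrite sqrt_Rsqr_abs. unfold Rdiv at 1. rewrite Rabs_mult.
    rewrite (Rabs_right (/ Cmod z)); [reflexivity|].
    left; now apply Rinv_0_lt_compat.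
  - unfold Rsqr.
    transitivity ((Cmod z * Cmod z - Re z * Re z) / (Cmod z * Cmod z))%R.
    + rewrite <- Hsq; replace (Re z * Re z + Im z * Im z - Re z * Re z)%R
        with (Im z * Im z)%R by ring.
      rewrite Hsq; field; lra.
    + field; lra. }
unfold Cexp, Clog, Carg; simpl.
rewrite (exp_ln _ Hm).
destruct (Rle_dec 0 (Im z)) as [Hi | Hi].
- rewrite cos_acos, sin_acos, Hs, Rabs_pos_eq by assumption.
  apply injective_projections; simpl; fold (Re z) (Im z); field; lra.
- rewrite cos_neg, sin_neg, cos_acos, sin_acos, Hs, Rabs_left
    by (assumption || lra).
  apply injective_projections; simpl; fold (Re z) (Im z); field; lra.
Qed.

Lemma Carg_bound (z : C) : z <> 0 -> (- PI < Carg z <= PI)%R.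
Proof.
intros Hz.
generalize (acos_bound (Re z / Cmod z)) PI_RGT_0; intros Hb Hpi.
unfold Carg; destruct (Rle_dec 0 (Im z)) as [Hi | Hi]; [lra|].
split; [|lra].
apply Ropp_lt_contravar.
destruct (Rle_lt_or_eq_dec _ _ (proj2 Hb)) as [H | H]; [exact H|].
exfalso.
generalize (Cexp_Clog z Hz); intros E.
apply (f_equal Im) in E.
unfold Cexp, Clog, Carg in E; simpl in E.
destruct (Rle_dec 0 (Im z)); [lra|].
rewrite H, sin_neg, sin_PI in E; lra.
Qed.

(* Main.v *)
Require Import Defs.
From Stdlib Require Import Reals Lra Lia Arith ZArith.
From Coquelicot Require Import Coquelicot.

(** The weighted cosine sum [fejerF z i] is [i] times the Fejer kernel of order
    [i] at the angle [2 PI z / i].  The kernel satisfies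
    [(1 - cos t) * F_i(t) = 1 - cos (i t)], and [i t] is a multiple of [2 PI]
    when [t = 2 PI n / i]; hence at an integer [n] the sum vanishes unless
    [cos t = 1], that is, unless [i] divides [n], and then it is [i ^ 2]
    ([fejerF_divisor]).  So [frakS] at [n] is the finite divisor sum
    [(q - 1) q * sum over i | n, i >= 2, of q ^ - i] ([frakS_divisors]).

    Dividing by [n ^ s = i ^ s * (n / i) ^ s] turns this into the Dirichlet
    convolution of [f i = q ^ - i * i ^ - s] (for [i >= 2], and [f 1 = 0]) with
    [g m = m ^ - s].  The sum of [f] is [Li_s (1 / q) - 1 / q], the sum of [g]
    is [zeta s], and the analogue of Mertens' theorem for Dirichlet
    convolutions ([is_Cseries_dirichlet_conv]) says that the series of the
    convolution converges to the product of the two sums.  That theorem rests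
    on the hyperbola identity
    [sum_(n <= N) (f * g) n = sum_(i <= N) f i * sum_(m <= N / i) g m]
    and on dominated convergence in the sum over [i] ([quotient_tannery]).

    The second series differs from the first by
    [(q - 1) q * sum_(n >= 2) q ^ - n * n ^ - s], which is
    [(q - 1) q * (Li_s (1 / q) - 1 / q)]; this lowers the factor [zeta s] by
    one. *)

Open Scope R_scope.

(** * The Fejer kernel at rational angles *)

(** [i] times the Fejer kernel; [fejerF z i] is its value at the angle
    [2 PI z / i] when [z] is real. *)
Definition fejer_sum (t : R) (i : nat) : R :=
  INR i + 2 * sum_n_m (fun k => (INR i - INR k) * cos (INR k * t)) 1 (i - 1).

(** The Fejer kernel is a running sum of Dirichlet kernels, so both closed
    forms below follow by induction on the order. *)
Lemma fejer_sum_S (t : R) (i : nat) :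
  fejer_sum t (S i)
  = fejer_sum t i + (1 + 2 * sum_n_m (fun k => cos (INR k * t)) 1 i).
Proof.
unfold fejer_sum.
(* The term of index [i] has the weight [0], so the range can be extended. *)
assert (E : sum_n_m (fun k => (INR i - INR k) * cos (INR k * t)) 1 (i - 1)
          = sum_n_m (fun k => (INR i - INR k) * cos (INR k * t)) 1 i).
{ destruct i as [|j].
  - reflexivity.
  - rewrite (sum_n_Sm _ 1 j) by lia.
    replace (S j - 1)%nat with j by lia.
    rewrite Rminus_diag, Rmult_0_l. symmetry. apply Rplus_0_r. }
rewrite E. replace (S i - 1)%nat with i by lia.
rewrite (sum_n_m_ext (fun k => (INR (S i) - INR k) * cos (INR k * t))
  (fun k => plus ((INR i - INR k) * cos (INR k * t)) (cos (INR k * t)))).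
- rewrite sum_n_m_plus, S_INR. unfold plus; simpl. ring.
- intros k. rewrite S_INR. unfold plus; simpl. ring.
Qed.

(** Multiplying by [1 - cos t] rather than by [sin (t / 2)] makes the sum
    telescope without half angles. *)
Lemma dirichlet_kernel_identity (t : R) (n : nat) :
  (1 - cos t) * (1 + 2 * sum_n_m (fun k => cos (INR k * t)) 1 n)
  = cos (INR n * t) - cos (INR (S n) * t).
Proof.
induction n as [|n IH].
- rewrite sum_n_m_zero by lia. unfold zero; simpl.
  rewrite Rmult_0_l, Rmult_1_l, cos_0. ring.
- rewrite sum_n_Sm by lia. unfold plus; simpl AbelianMonoid.sort in *; simpl.
  change (match n with 0%nat => 1 | S _ => INR n + 1 end) with (INR (S n)).
  set (s := sum_n_m _ _ _) in *.
  replace ((1 - cos t) * (1 + 2 * (s + cos (INR (S n) * t))))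
    with ((1 - cos t) * (1 + 2 * s) + (1 - cos t) * 2 * cos (INR (S n) * t))
    by ring.
  rewrite IH.
  replace (INR n * t) with (INR (S n) * t - t) by (rewrite S_INR; ring).
  replace ((INR (S n) + 1) * t) with (INR (S n) * t + t) by ring.
  rewrite cos_minus, cos_plus. ring.
Qed.

Lemma fejer_kernel_identity (t : R) (i : nat) :
  (1 - cos t) * fejer_sum t i = 1 - cos (INR i * t).
Proof.
induction i as [|i IH].
- unfold fejer_sum. rewrite sum_n_m_zero by lia. unfold zero; simpl.
  rewrite Rmult_0_l, cos_0. ring.
- rewrite fejer_sum_S, Rmult_plus_distr_l, IH, dirichlet_kernel_identity. ring.
Qed.

Lemma cos_2PI_nat (k : nat) : cos (2 * PI * INR k) = 1.
Proof.
replace (2 * PI * INR k) with (0 + 2 * INR k * PI) by ring.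
now rewrite cos_period, cos_0.
Qed.

Lemma fejer_sum_of_period (m i : nat) :
  fejer_sum (2 * PI * INR m) i = INR i ^ 2.
Proof.
assert (H : forall n,
  sum_n_m (fun k => cos (INR k * (2 * PI * INR m))) 1 n = INR n).
{ intros n. rewrite (sum_n_m_ext _ (fun _ => 1)).
  - rewrite sum_n_m_const. replace (S n - 1)%nat with n by lia. apply Rmult_1_r.
  - intros k. replace (INR k * (2 * PI * INR m))
      with (2 * PI * INR (k * m)) by (rewrite mult_INR; ring).
    apply cos_2PI_nat. }
induction i as [|i IH].
- unfold fejer_sum. rewrite sum_n_m_zero by lia. unfold zero; simpl. ring.
- rewrite fejer_sum_S, IH, H, S_INR. ring.
Qed.

Lemma cos_eq_1_2PI (x : R) : cos x = 1 -> exists k : Z, x = 2 * PI * IZR k.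
Proof.
intros H.
assert (Hs : sin (x / 2) = 0).
{ replace x with (2 * (x / 2)) in H by field.
  rewrite cos_2a_sin in H. nra. }
destruct (sin_eq_0_0 _ Hs) as [k Hk]. exists k. lra.
Qed.

Lemma divide_of_cos_eq_1 (n i : nat) :
  (0 < i)%nat -> cos (2 * PI * INR n / INR i) = 1 -> Nat.divide i n.
Proof.
intros Hi H. apply lt_INR in Hi; simpl in Hi.
destruct (cos_eq_1_2PI _ H) as [k Hk].
assert (E : INR n = INR i * IZR k).
{ apply (Rmult_eq_reg_l (2 * PI)).
  - apply (f_equal (fun y => INR i * y)) in Hk. field_simplify in Hk; [|lra].
    rewrite Hk; ring.
  - generalize PI_RGT_0; lra. }
rewrite !INR_IZR_INZ, <- mult_IZR in E. apply eq_IZR in E.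
exists (Z.to_nat k). apply Nat2Z.inj. rewrite INR_IZR_INZ in Hi.
apply lt_IZR in Hi.
rewrite Nat2Z.inj_mul, Z2Nat.id; nia.
Qed.

(** If [i] divides [n], every cosine is [1]; otherwise [1 - cos t] is nonzero
    while [1 - cos (i t) = 1 - cos (2 PI n) = 0]. *)
Lemma fejer_sum_divisor (n i : nat) :
  (0 < i)%nat ->
  fejer_sum (2 * PI * INR n / INR i) i
  = if (n mod i =? 0)%nat then INR i ^ 2 else 0.
Proof.
intros Hi. assert (Hi' : 0 < INR i) by now apply lt_0_INR.
destruct (Nat.eqb_spec (n mod i) 0) as [H|H].
- apply Nat.Lcm0.mod_divide in H. destruct H as [m ->].
  rewrite <- (fejer_sum_of_period m). f_equal.
  rewrite mult_INR. field. lra.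
- generalize (fejer_kernel_identity (2 * PI * INR n / INR i) i).
  replace (INR i * (2 * PI * INR n / INR i)) with (2 * PI * INR n)
    by (field; lra).
  rewrite cos_2PI_nat, Rminus_diag. intros E.
  apply Rmult_integral in E. destruct E as [E|E]; [exfalso|exact E].
  apply H, Nat.Lcm0.mod_divide, divide_of_cos_eq_1; [exact Hi|lra].
Qed.

Open Scope C_scope.

Lemma Cexp_plus (a b : C) : Cexp (a + b) = Cexp a * Cexp b.
Proof.
unfold Cexp; destruct a as [a1 a2], b as [b1 b2]; simpl.
rewrite exp_plus, cos_plus, sin_plus.
apply injective_projections; simpl; ring.
Qed.

Lemma Ccos_RtoC (x : R) : Ccos x = cos x.
Proof.
unfold Ccos, Cexp; simpl.
apply injective_projections; simpl; rewrite ?Rmult_0_l, ?Rmult_1_l, ?Rmult_0_r;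
 rewrite ?Rminus_0_r, ?Rplus_0_l, ?Rplus_0_r, ?Ropp_0, ?exp_0, ?cos_neg, ?sin_neg; field.
Qed.

Lemma RtoC_sum_n_m (u : nat -> R) (n m : nat) :
  RtoC (sum_n_m u n m) = sum_n_m (fun k => RtoC (u k)) n m.
Proof.
destruct (le_lt_dec n m) as [H|H].
- induction H as [|m H IH].
  + now rewrite !sum_n_n.
  + rewrite !sum_n_Sm, <- IH by lia. apply RtoC_plus.
- rewrite !sum_n_m_zero by lia. reflexivity.
Qed.

Lemma fejerF_divisor (n i : nat) :
  (0 < i)%nat ->
  fejerF (INR n) i = if (n mod i =? 0)%nat then RtoC (INR i) ^ 2 else 0.
Proof.
intros Hi. assert (Hi' : (0 < INR i)%R) by now apply lt_0_INR.
transitivity (RtoC (fejer_sum (2 * PI * INR n / INR i)%R i)).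
- unfold fejerF, fejer_sum. rewrite RtoC_plus, RtoC_mult, RtoC_sum_n_m.
  do 2 f_equal. apply sum_n_m_ext. intros k.
  rewrite RtoC_mult, RtoC_minus, <- Ccos_RtoC. do 2 f_equal.
  rewrite <- !RtoC_mult, <- RtoC_div by lra. f_equal. field. lra.
- rewrite (fejer_sum_divisor n i Hi).
  destruct (n mod i =? 0)%nat; [apply RtoC_pow|reflexivity].
Qed.

(** * Series of Dirichlet convolutions *)

Open Scope R_scope.

Lemma sum_n_m_le_loc (a b : nat -> R) (n m : nat) :
  (forall k, (n <= k <= m)%nat -> a k <= b k) -> sum_n_m a n m <= sum_n_m b n m.
Proof.
intros H. destruct (le_lt_dec n m) as [L|L].
- induction L as [|m L IH].
  + rewrite !sum_n_n. apply H; lia.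
  + rewrite !sum_n_Sm by lia. apply Rplus_le_compat.
    * apply IH. intros k Hk; apply H; lia.
    * apply H; lia.
- rewrite !sum_n_m_zero by lia. apply Rle_refl.
Qed.

Lemma filterlim_div_nat (K : nat) :
  (0 < K)%nat -> filterlim (fun N => (N / K)%nat) eventually eventually.
Proof.
intros HK P [N0 H]. exists (K * N0)%nat. intros n Hn. apply H.
apply Nat.div_le_lower_bound; lia.
Qed.

(** Dominated convergence for sums whose terms and range both depend on [N].
    Choose [K] with [d] small beyond [K].  For [i <= N / K] the quotient [N / i]
    is at least [K], so these terms contribute at most a small multiple of [B];
    the terms with [i > N / K] contribute at most [M] times a piece of the tail
    of [b], and [N / K] tends to infinity. *)
Lemma quotient_tannery (b d : nat -> R) (B M : R) :
  (forall i, 0 <= b i) -> (forall k, 0 <= d k <= M) ->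
  is_lim_seq (sum_n_m b 1) B -> is_lim_seq d 0 ->
  is_lim_seq (fun N => sum_n_m (fun i => b i * d (N / i)%nat) 1 N) 0.
Proof.
intros Hb Hd HB H0.
assert (HM : 0 <= M) by (generalize (Hd 0%nat); lra).
assert (Hpos : forall (u : nat -> R) n m, (forall i, 0 <= u i) -> 0 <= sum_n_m u n m).
{ intros u n m Hu. apply Rle_trans with (sum_n_m (fun _ => 0) n m).
  - right; symmetry. apply (sum_n_m_const_zero (G := R_AbelianMonoid)).
  - apply sum_n_m_le. exact Hu. }
assert (HSB : forall N, sum_n_m b 1 N <= B).
{ intros N. apply (is_lim_seq_incr_compare (sum_n_m b 1)); [exact HB|].
  intros n. rewrite sum_n_Sm by lia. unfold plus; simpl.
  generalize (Hb (S n)); lra. }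
assert (HB0 : 0 <= B).
{ eapply Rle_trans; [|apply (HSB 0%nat)]. now apply Hpos. }
apply is_lim_seq_spec. intros [eps Heps]; simpl.
apply is_lim_seq_spec in H0.
assert (He1 : 0 < eps / (2 * (B + 1))) by (apply Rdiv_lt_0_compat; lra).
destruct (H0 (mkposreal _ He1)) as [K HK]; simpl in HK.
assert (HT : is_lim_seq
  (fun N => sum_n_m b 1 N - sum_n_m b 1 (N / S K)) (B - B)).
{ apply is_lim_seq_minus'; [exact HB|].
  apply (is_lim_seq_subseq (sum_n_m b 1) B (fun N => (N / S K)%nat)); [|exact HB].
  apply filterlim_div_nat; lia. }
rewrite Rminus_diag in HT. apply is_lim_seq_spec in HT.
assert (He2 : 0 < eps / (2 * (M + 1))) by (apply Rdiv_lt_0_compat; lra).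
destruct (HT (mkposreal _ He2)) as [N1 HN1]; simpl in HN1.
exists N1. intros N HN. specialize (HN1 N HN).
rewrite Rminus_0_r in *.
rewrite Rabs_pos_eq
  by (apply Hpos; intros i; apply Rmult_le_pos; [apply Hb|apply Hd]).
assert (HNK : (N / S K <= N)%nat) by (apply Nat.Div0.div_le_upper_bound; nia).
rewrite (sum_n_m_Chasles _ 1 (N / S K) N) by lia.
rewrite (sum_n_m_Chasles _ 1 (N / S K) N) in HN1 by lia.
unfold plus in *; simpl in *.
assert (L1 : sum_n_m (fun i => b i * d (N / i)%nat) 1 (N / S K)
             <= eps / (2 * (B + 1)) * B).
{ apply Rle_trans with (eps / (2 * (B + 1)) * sum_n_m b 1 (N / S K)).
  - rewrite <- (sum_n_m_mult_l (K := R_Ring)). apply sum_n_m_le_loc.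
    intros i Hi. unfold mult; simpl. rewrite Rmult_comm.
    apply Rmult_le_compat_r; [apply Hb|].
    assert (Hq : (K <= N / i)%nat).
    { apply Nat.div_le_lower_bound; [lia|].
      generalize (Nat.Div0.mul_div_le N (S K)). nia. }
    specialize (HK _ Hq). rewrite Rminus_0_r in HK.
    apply Rabs_def2 in HK. lra.
  - apply Rmult_le_compat_l; [lra|apply HSB]. }
assert (L2 : sum_n_m (fun i => b i * d (N / i)%nat) (S (N / S K)) N
             <= M * sum_n_m b (S (N / S K)) N).
{ rewrite <- (sum_n_m_mult_l (K := R_Ring)). apply sum_n_m_le.
  intros i. unfold mult; simpl. rewrite Rmult_comm.
  apply Rmult_le_compat_r; [apply Hb|apply Hd]. }
rewrite Rplus_minus_l in HN1.
apply Rabs_def2 in HN1. destruct HN1 as [HN1 _].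
assert (L3 : eps / (2 * (B + 1)) * B <= eps / 2).
{ apply Rle_trans with (eps / (2 * (B + 1)) * (B + 1)).
  - apply Rmult_le_compat_l; lra.
  - right; field; lra. }
assert (L4 : forall y, y < eps / (2 * (M + 1)) -> M * y < eps / 2).
{ intros y Hy. apply Rle_lt_trans with ((M + 1 - 1) * (eps / (2 * (M + 1)))).
  - replace (M + 1 - 1) with M by ring. apply Rmult_le_compat_l; lra.
  - rewrite Rmult_minus_distr_r.
    replace ((M + 1) * (eps / (2 * (M + 1)))) with (eps / 2) by (field; lra). lra. }
replace eps with (eps / 2 + eps / 2) by field.
apply Rplus_le_lt_compat.
- exact (Rle_trans _ _ _ L1 L3).
- exact (Rle_lt_trans _ _ _ L2 (L4 _ HN1)).
Qed.

Open Scope C_scope.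

Lemma filterlim_Cmod (u : nat -> C) (l : C) :
  filterlim u eventually (locally (T := C_UniformSpace) l)
  <-> is_lim_seq (fun n => Cmod (u n - l)) 0.
Proof.
rewrite <- is_lim_seq_spec. split.
- intros H eps.
  generalize (proj1 (filterlim_locally_ball_norm (K := C_AbsRing)
    (U := C_NormedModule) u l) H eps).
  apply filter_imp. intros n Hn. rewrite Rminus_0_r, Rabs_pos_eq by apply Cmod_ge_0.
  exact Hn.
- intros H.
  apply (filterlim_locally_ball_norm (K := C_AbsRing) (U := C_NormedModule)).
  intros eps. generalize (H eps). apply filter_imp. intros n Hn.
  rewrite Rminus_0_r, Rabs_pos_eq in Hn by apply Cmod_ge_0. exact Hn.
Qed.

Lemma is_Cseries_from_1_Cmod (a : nat -> C) (l : C) :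
  is_Cseries_from 1 a l
  <-> is_lim_seq (fun N => Cmod (sum_n_m a 1 N - l)) 0.
Proof.
transitivity (is_lim_seq (fun n => Cmod (sum_n (fun k => a (1 + k)%nat) n - l)) 0).
- apply filterlim_Cmod.
- rewrite (is_lim_seq_incr_1 (fun N => Cmod (sum_n_m a 1 N - l))).
  split; apply is_lim_seq_ext; intros n; unfold sum_n; now rewrite <- sum_n_m_S.
Qed.

(** A finite sum has the carrier of an algebraic structure as its type; adding
    [0] in front makes the left-hand side a sum of complex numbers, for which
    [ring] finds the ring structure. *)
Ltac C_ring :=
  unfold plus, mult, opp, zero; simpl;
  match goal with |- @eq _ ?a ?b =>
    apply (@eq_trans C a (Cplus 0 a) b); [symmetry; apply Cplus_0_l|]
  end; ring.

Definition dirichlet_conv (f g : nat -> C) (n : nat) : C :=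
  sum_n_m (fun i => if (n mod i =? 0)%nat then f i * g (n / i)%nat else RtoC 0) 1 n.

(** [N / i] counts the multiples of [i] up to [N], so it grows exactly when the
    next integer is one of them. *)
Lemma div_S_nat (n i : nat) :
  (0 < i)%nat ->
  (S n / i = if S n mod i =? 0 then S (n / i) else n / i)%nat.
Proof.
intros Hi.
generalize (Nat.div_mod n i) (Nat.mod_upper_bound n i)
  (Nat.div_mod (S n) i) (Nat.mod_upper_bound (S n) i).
destruct (Nat.eqb_spec (S n mod i) 0); intros; nia.
Qed.

(** Dirichlet's hyperbola identity: both sides sum [f i * g m] over [i m <= N]. *)
Lemma sum_dirichlet_conv (f g : nat -> C) (N : nat) :
  sum_n_m (dirichlet_conv f g) 1 N
  = sum_n_m (fun i => f i * sum_n_m g 1 (N / i)) 1 N.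
Proof.
induction N as [|N IH].
- now rewrite !sum_n_m_zero by lia.
- rewrite sum_n_Sm, IH by lia.
  rewrite (sum_n_m_ext_loc (fun i => f i * sum_n_m g 1 (S N / i))
    (fun i => plus (f i * sum_n_m g 1 (N / i))
       (if (S N mod i =? 0)%nat then f i * g (S N / i)%nat else RtoC 0))).
  + rewrite sum_n_m_plus. f_equal.
    rewrite sum_n_Sm by lia. rewrite (Nat.div_small N (S N)) by lia.
    rewrite (sum_n_m_zero g) by lia. C_ring.
  + intros i Hi. rewrite div_S_nat by lia.
    destruct (S N mod i =? 0)%nat.
    * rewrite sum_n_Sm by lia. C_ring.
    * C_ring.
Qed.

(** By the hyperbola identity the error [sum_(n <= N) (f * g) n - F G] equals
    [sum_(i <= N) f i * (sum_(m <= N / i) g m - G) + G * (sum_(i <= N) f i - F)].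
    The partial sums of [g] converge to [G], hence are bounded, so the first
    sum tends to [0] by [quotient_tannery].  As in Mertens' theorem, only one
    of the two series has to converge absolutely. *)
Lemma is_Cseries_dirichlet_conv (f g : nat -> C) (F G : C) :
  is_Cseries_from 1 f F ->
  ex_series (fun k => Cmod (f (S k))) ->
  is_Cseries_from 1 g G ->
  is_Cseries_from 1 (dirichlet_conv f g) (F * G).
Proof.
intros Hf [B HB] Hg.
apply is_Cseries_from_1_Cmod in Hf. apply is_Cseries_from_1_Cmod in Hg.
apply is_Cseries_from_1_Cmod.
set (d := fun k => Cmod (sum_n_m g 1 k - G)) in *.
assert (HS : is_lim_seq (sum_n_m (fun i => Cmod (f i)) 1) B).
{ apply is_lim_seq_incr_1.
  apply is_lim_seq_ext with (sum_n (fun k => Cmod (f (S k)))); [|exact HB].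
  intros n. unfold sum_n. now rewrite <- sum_n_m_S. }
assert (HM : exists M, forall k, (0 <= d k <= M)%R).
{ destruct (filterlim_bounded (V := R_NormedModule) d) as [M HM].
  - exists 0%R. exact Hg.
  - exists M. intros k. split; [apply Cmod_ge_0|].
    eapply Rle_trans; [apply Rle_abs|apply HM]. }
destruct HM as [M HM].
assert (HT := quotient_tannery _ d B M (fun i => Cmod_ge_0 (f i)) HM HS Hg).
assert (Hlim := is_lim_seq_plus' _ _ _ _ HT
  (is_lim_seq_scal_l _ (Cmod G) _ Hf)).
replace (0 + Cmod G * 0)%R with 0%R in Hlim by ring.
refine (is_lim_seq_le_le (fun _ => 0%R) _ _ 0 _ (is_lim_seq_const 0) Hlim).
intros N. split; [apply Cmod_ge_0|].
rewrite sum_dirichlet_conv.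
replace (sum_n_m (fun i => f i * sum_n_m g 1 (N / i)) 1 N - F * G)
  with (sum_n_m (fun i => f i * (sum_n_m g 1 (N / i) - G)) 1 N
        + G * (sum_n_m f 1 N - F)).
- eapply Rle_trans; [apply Cmod_triangle|].
  rewrite Cmod_mult. apply Rplus_le_compat_r.
  eapply Rle_trans.
  + apply (norm_sum_n_m (K := C_AbsRing) (V := C_NormedModule)).
  + right. apply sum_n_m_ext. intros i. exact (Cmod_mult _ _).
- rewrite (sum_n_m_ext (fun i => f i * sum_n_m g 1 (N / i))
    (fun i => plus (f i * (sum_n_m g 1 (N / i) - G)) (f i * G))).
  + assert (E : sum_n_m (fun i => f i * G) 1 N = sum_n_m f 1 N * G)
      by apply (sum_n_m_mult_r (K := C_Ring)).
    rewrite sum_n_m_plus, E.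
    C_ring.
  + intros i. C_ring.
Qed.

(** * Complex exponentials and powers *)

Lemma Cexp_0 : Cexp 0 = 1.
Proof.
unfold Cexp; simpl. rewrite exp_0, cos_0, sin_0.
apply injective_projections; simpl; ring.
Qed.

Lemma Cmod_Cexp (z : C) : Cmod (Cexp z) = exp (Re z).
Proof.
unfold Cexp, Cmod; simpl fst; simpl snd.
generalize (sin2_cos2 (Im z)) (exp_pos (Re z)). unfold Rsqr. intros H Hp.
rewrite <- (sqrt_pow2 (exp (Re z))) at 3 by lra. f_equal. simpl. nra.
Qed.

Lemma Cexp_neq_0 (z : C) : Cexp z <> 0.
Proof.
apply Cmod_gt_0. rewrite Cmod_Cexp. apply exp_pos.
Qed.

Lemma Cexp_opp (z : C) : Cexp (- z) = / Cexp z.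
Proof.
assert (H := Cexp_neq_0 z).
replace (/ Cexp z) with (Cexp (- z + z) * / Cexp z).
- rewrite Cexp_plus. field. exact H.
- replace (- z + z) with (RtoC 0) by ring. rewrite Cexp_0. ring.
Qed.

Lemma Cexp_INR_mult (n : nat) (z : C) : Cexp (INR n * z) = Cexp z ^ n.
Proof.
induction n as [|n IH].
- simpl INR. rewrite Cmult_0_l. apply Cexp_0.
- rewrite S_INR, RtoC_plus, Cmult_plus_distr_r, Cexp_plus, IH, Cmult_1_l, Cpow_S.
  ring.
Qed.

Lemma Cpower_opp (w s : C) : Cpower w (- s) = / Cpower w s.
Proof.
unfold Cpower. rewrite <- Cexp_opp. f_equal. ring.
Qed.

Lemma Cpower_neq_0 (w s : C) : Cpower w s <> 0.
Proof. apply Cexp_neq_0. Qed.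

(** At integers the power does not see the choice of the logarithm, since
    [Cexp (n * Clog q) = q ^ n]. *)
Lemma Cpower_opp_INR (q : C) (n : nat) :
  q <> 0 -> Cpower q (- INR n) = (1 / q) ^ n.
Proof.
intros Hq. rewrite Cpower_opp. unfold Cpower.
rewrite Cexp_INR_mult, Cexp_Clog by exact Hq.
unfold Cdiv. rewrite Cmult_1_l. symmetry. now apply Cpow_inv.
Qed.

Lemma Clog_pos (x : R) : (0 < x)%R -> Clog x = ln x.
Proof.
intros Hx. unfold Clog, Carg. rewrite Cmod_R, Rabs_pos_eq by lra. simpl.
destruct (Rle_dec 0 0); [|lra].
unfold Rdiv. rewrite Rinv_r by lra. now rewrite acos_1.
Qed.

Lemma Cpower_mult_pos (x y : R) (s : C) :
  (0 < x)%R -> (0 < y)%R -> Cpower (x * y)%R s = Cpower x s * Cpower y s.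
Proof.
intros Hx Hy. unfold Cpower.
rewrite !Clog_pos, ln_mult, RtoC_plus, <- Cexp_plus
  by (try apply Rmult_lt_0_compat; assumption).
f_equal. ring.
Qed.

Lemma Cpower_1_l (s : C) : Cpower 1 s = 1.
Proof.
unfold Cpower. rewrite Clog_pos, ln_1, Cmult_0_r by lra. apply Cexp_0.
Qed.

Lemma Cmod_Cpower_pos (x : R) (s : C) :
  (0 < x)%R -> Cmod (Cpower x s) = exp (Re s * ln x).
Proof.
intros Hx. unfold Cpower. rewrite Cmod_Cexp, Clog_pos by exact Hx.
f_equal. unfold Re; simpl. ring.
Qed.

(** * Convergence of the zeta and polylogarithm series *)

(** The comparison of [(x + 1) ^ (- 1 - d)] with the integral of
    [y ^ (- 1 - d)] over [[x, x + 1]], obtained from two uses of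
    [exp y >= 1 + y]: one for [ln (x + 1) - ln x >= 1 / (x + 1)] and one for
    [exp (d * (ln (x + 1) - ln x))]. *)
Lemma Rpower_telescope (d x : R) :
  (0 < d)%R -> (0 < x)%R ->
  (d * exp (- ((1 + d) * ln (x + 1)))
   <= exp (- (d * ln x)) - exp (- (d * ln (x + 1))))%R.
Proof.
intros Hd Hx. set (u := ln x). set (v := ln (x + 1)).
assert (Huv : (exp (- v) <= v - u)%R).
{ assert (E := exp_ineq1_le (u - v)).
  assert (Ev : exp v = (x + 1)%R) by (apply exp_ln; lra).
  assert (Eu : exp u = x) by (apply exp_ln; lra).
  unfold Rminus in E; rewrite exp_plus, exp_Ropp, Eu, Ev in E.
  rewrite exp_Ropp, Ev.
  replace (/ (x + 1))%R with (1 - x * / (x + 1))%R by (field; lra). lra. }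
replace (- (d * u))%R with (- (d * v) + d * (v - u))%R by ring.
replace (- ((1 + d) * v))%R with (- (d * v) + - v)%R by ring.
rewrite !exp_plus.
assert (E := exp_ineq1_le (d * (v - u))).
assert (Hp := exp_pos (- (d * v))).
assert (H1 : (d * exp (- v) <= d * (v - u))%R) by (apply Rmult_le_compat_l; lra).
apply Rle_trans with (exp (- (d * v)) * (d * (v - u)))%R; nra.
Qed.

(** The partial sums increase and, by [Rpower_telescope] with [d = Re s - 1],
    stay below [1 + 1 / d]. *)
Lemma zeta_abs_cv (s : C) :
  (1 < Re s)%R -> ex_series (fun k => Cmod (/ Cpower (INR (S k)) s)).
Proof.
intros Hs. set (d := (Re s - 1)%R).
assert (Hd : (0 < d)%R) by (unfold d; lra).
assert (Ea : forall k, Cmod (/ Cpower (INR (S k)) s)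
                       = exp (- ((1 + d) * ln (INR (S k))))).
{ intros k. rewrite Cmod_inv, Cmod_Cpower_pos
    by (try apply Cpower_neq_0; apply lt_0_INR; lia).
  rewrite <- exp_Ropp. f_equal. unfold d. ring. }
apply (ex_series_ext (fun k => exp (- ((1 + d) * ln (INR (S k)))))).
{ intros k. symmetry. apply Ea. }
set (a := fun k => exp (- ((1 + d) * ln (INR (S k))))).
apply (ex_finite_lim_seq_incr _ (1 + / d)).
- intros n. rewrite sum_Sn. unfold plus; simpl.
  assert (0 < a (S n))%R by apply exp_pos.
  change (sum_n a n <= sum_n a n + a (S n))%R. lra.
- intros n.
  assert (H : (sum_n a n <= 1 + / d * (1 - exp (- (d * ln (INR (S n))))))%R).
  { induction n as [|n IH].
    - rewrite sum_O. unfold a. simpl INR. rewrite ln_1, !Rmult_0_r, !Ropp_0, exp_0. lra.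
    - rewrite sum_Sn. apply Rle_trans with (1 := Rplus_le_compat_r (a (S n)) _ _ IH).
      assert (T := Rpower_telescope d (INR (S n)) Hd (lt_0_INR _ (Nat.lt_0_succ n))).
      rewrite <- S_INR in T. fold (a (S n)) in T.
      apply (Rmult_le_compat_l (/ d)) in T; [|left; now apply Rinv_0_lt_compat].
      rewrite <- Rmult_assoc, Rinv_l, Rmult_1_l in T by lra. lra. }
  apply Rle_trans with (1 := H).
  assert (Hp := exp_pos (- (d * ln (INR (S n))))).
  assert (Hi := Rinv_0_lt_compat d Hd). nra.
Qed.

Lemma Cseries_from_1_correct (a : nat -> C) (b : nat -> R) :
  (forall k, Cmod (a (S k)) <= b k)%R -> ex_series b ->
  is_Cseries_from 1 a (Cseries_from 1 a).
Proof.
intros Ha Hb.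
destruct (ex_series_le (V := C_CompleteNormedModule) (fun k => a (S k)) b Ha Hb)
  as [l Hl].
now rewrite (Cseries_from_unique 1 a l Hl).
Qed.

Lemma is_zeta (s : C) :
  (1 < Re s)%R -> is_Cseries_from 1 (fun n => / Cpower (INR n) s) (zeta s).
Proof.
intros Hs. eapply Cseries_from_1_correct; [|now apply (zeta_abs_cv s)].
intros k. apply Rle_refl.
Qed.

Lemma Cmod_polylog_term (s w : C) (n : nat) :
  (Cmod w <= 1)%R ->
  (Cmod (w ^ n * Cpower (INR n) (- s)) <= Cmod (/ Cpower (INR n) s))%R.
Proof.
intros Hw. rewrite Cpower_opp, Cmod_mult, Cmod_pow.
rewrite <- Rmult_1_l. apply Rmult_le_compat_r; [apply Cmod_ge_0|].
rewrite <- (pow1 n). apply pow_incr. split; [apply Cmod_ge_0|exact Hw].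
Qed.

(** Inside the closed unit disc the terms are dominated by those of the zeta
    series. *)
Lemma is_polylog (s w : C) :
  (1 < Re s)%R -> (Cmod w <= 1)%R ->
  is_Cseries_from 1 (fun n => w ^ n * Cpower (INR n) (- s)) (polylog s w).
Proof.
intros Hs Hw. eapply Cseries_from_1_correct; [|now apply (zeta_abs_cv s)].
intros k. now apply Cmod_polylog_term.
Qed.

(** * The divisor sum and the two Dirichlet series *)

Lemma is_Cseries_from_1_2 (a : nat -> C) (l : C) :
  is_Cseries_from 1 a l <-> is_Cseries_from 2 a (l - a 1%nat).
Proof.
split; intros H.
- apply (is_series_incr_1 (fun k => a (1 + k)%nat)).
  refine (eq_ind l (is_Cseries_from 1 a) H _ _).
  change (l = (l - a 1%nat) + a 1%nat). ring.
- apply (is_series_decr_1 (fun k => a (1 + k)%nat)). exact H.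
Qed.

Lemma is_Cseries_from_ext (m : nat) (a b : nat -> C) (l : C) :
  (forall n, (m <= n)%nat -> a n = b n) ->
  is_Cseries_from m a l -> is_Cseries_from m b l.
Proof.
intros H. apply is_series_ext. intros k. apply H. lia.
Qed.

Lemma is_Cseries_from_1_finite (a : nat -> C) (n : nat) :
  (forall i, (n < i)%nat -> a i = 0) ->
  is_Cseries_from 1 a (sum_n_m a 1 n).
Proof.
intros H. apply is_Cseries_from_1_Cmod.
apply (is_lim_seq_ext_loc (fun _ => 0%R)); [|apply is_lim_seq_const].
exists n. intros N HN.
assert (E : sum_n_m a 1 N = sum_n_m a 1 n).
{ induction HN as [|N HN IH]; [reflexivity|].
  rewrite sum_n_Sm, IH, H by lia. apply Cplus_0_r. }
rewrite E. symmetry.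
replace (sum_n_m a 1 n - sum_n_m a 1 n) with (RtoC 0) by (symmetry; apply Cplus_opp_r).
apply Cmod_0.
Qed.

(** Since [i] can divide [n > 0] only if [i <= n], the series over [i >= 2] is a
    finite sum.  The range starts at [1], with a zero term there, to match the
    range of [dirichlet_conv]. *)
Lemma frakS_divisors (q : C) (n : nat) :
  (0 < n)%nat ->
  frakS (INR n) q
  = (q - 1) * q *
    sum_n_m (fun i => if (i =? 1)%nat then RtoC 0
                      else if (n mod i =? 0)%nat then / q ^ i else RtoC 0) 1 n.
Proof.
intros Hn. unfold frakS. f_equal. apply Cseries_from_unique.
set (b := fun i => if (i =? 1)%nat then _ else _).
apply (is_Cseries_from_ext 2 b).
- intros i Hi. unfold b. rewrite fejerF_divisor by lia.
  destruct (Nat.eqb_spec i 1); [lia|].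
  destruct (n mod i =? 0)%nat.
  + unfold Cdiv. rewrite Cinv_r; [now rewrite Cmult_1_l|].
    apply Cpow_nz. intros E. apply RtoC_inj in E. revert E. apply not_0_INR. lia.
  + unfold Cdiv. now rewrite !Cmult_0_l.
- replace (sum_n_m b 1 n) with (sum_n_m b 1 n - b 1%nat)
    by (change (b 1%nat) with (RtoC 0); C_ring).
  apply is_Cseries_from_1_2, is_Cseries_from_1_finite.
  intros i Hi. unfold b. destruct (i =? 1)%nat; [reflexivity|].
  rewrite Nat.mod_small by lia. destruct (Nat.eqb_spec n 0); [lia|reflexivity].
Qed.

Theorem theorem5p1 :
  forall q s : C,
    (1 < Cmod q)%R ->
    (1 < Re s)%R ->
    is_Cseries_from 2 (fun n : nat => frakS (INR n) q / Cpower (INR n) s)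
      ((q - 1) * q * zeta s * (polylog s (1 / q) - / q))
    /\
    is_Cseries_from 2 (fun n : nat => frakF (INR n) q / Cpower (INR n) s)
      ((q - 1) * q * (zeta s - 1) * (polylog s (1 / q) - / q)).
Proof.
intros q s Hq Hs.
assert (Hq0 : q <> 0) by (apply Cmod_gt_0; lra).
assert (Hw : (Cmod (1 / q) <= 1)%R).
{ rewrite Cmod_div, Cmod_1 by exact Hq0. apply Rle_div_l; lra. }
set (p := fun n : nat => (1 / q) ^ n * Cpower (INR n) (- s)).
(* [frakS] sums over [i >= 2], hence the term of index [1] is removed. *)
set (f := fun i => if (i =? 1)%nat then RtoC 0 else p i).
set (g := fun n : nat => / Cpower (INR n) s).
assert (Hp1 : p 1%nat = / q).
{ unfold p. rewrite Cpower_opp. simpl INR. rewrite Cpower_1_l. field. exact Hq0. }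
assert (Hp : is_Cseries_from 2 p (polylog s (1 / q) - / q)).
{ rewrite <- Hp1. apply is_Cseries_from_1_2. now apply is_polylog. }
assert (Hf : is_Cseries_from 1 f (polylog s (1 / q) - / q)).
{ apply is_Cseries_from_1_2. change (f 1%nat) with (RtoC 0).
  replace (polylog s (1 / q) - / q - 0) with (polylog s (1 / q) - / q) by ring.
  apply (is_Cseries_from_ext 2 p); [|exact Hp].
  intros n Hn. unfold f. destruct (Nat.eqb_spec n 1); [lia|reflexivity]. }
assert (Hfabs : ex_series (fun k => Cmod (f (S k)))).
{ apply (ex_series_le (V := R_CompleteNormedModule) _
    (fun k => Cmod (/ Cpower (INR (S k)) s))); [|now apply zeta_abs_cv].
  intros k. eapply Rle_trans; [right; apply Rabs_pos_eq, Cmod_ge_0|].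
  unfold f. destruct (S k =? 1)%nat.
  - rewrite Cmod_0. apply Cmod_ge_0.
  - now apply Cmod_polylog_term. }
assert (Hfg := is_Cseries_dirichlet_conv f g _ _ Hf Hfabs (is_zeta s Hs)).
apply is_Cseries_from_1_2 in Hfg.
(* For [n = i * m] the power [n ^ s] splits as [i ^ s * m ^ s]. *)
assert (Hterm : forall n, (0 < n)%nat ->
  frakS (INR n) q / Cpower (INR n) s = (q - 1) * q * dirichlet_conv f g n).
{ intros n Hn. rewrite frakS_divisors by exact Hn.
  unfold Cdiv. rewrite <- (Cmult_assoc ((q - 1) * q)). f_equal.
  etransitivity; [symmetry; apply (sum_n_m_mult_r (K := C_Ring))|].
  apply (sum_n_m_ext_loc (G := C_AbelianMonoid)). intros i Hi.
  unfold f. destruct (i =? 1)%nat.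
  - destruct (n mod i =? 0)%nat; C_ring.
  - destruct (Nat.eqb_spec (n mod i) 0) as [H|H]; [|C_ring].
    apply Nat.Lcm0.mod_divide in H. destruct H as [m ->].
    rewrite Nat.div_mul by lia. unfold p, g.
    rewrite mult_INR, Cpower_mult_pos, Cpower_opp by (apply lt_0_INR; nia).
    unfold mult; simpl. unfold Cdiv. rewrite Cmult_1_l, Cpow_inv by exact Hq0.
    field. repeat split; try apply Cpower_neq_0. now apply Cpow_nz. }
assert (HS : is_Cseries_from 2 (fun n : nat => frakS (INR n) q / Cpower (INR n) s)
      ((q - 1) * q * zeta s * (polylog s (1 / q) - / q))).
{ apply (is_Cseries_from_ext 2 (fun n => (q - 1) * q * dirichlet_conv f g n)).
  - intros n Hn. symmetry. apply Hterm. lia.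
  - replace (dirichlet_conv f g 1) with (RtoC 0) in Hfg.
    + replace ((q - 1) * q * zeta s * (polylog s (1 / q) - / q))
        with ((q - 1) * q * ((polylog s (1 / q) - / q) * zeta s - 0)) by ring.
      exact (is_series_scal_l (V := C_NormedModule) ((q - 1) * q) _ _ Hfg).
    + unfold dirichlet_conv. rewrite sum_n_n.
      change (RtoC 0 = RtoC 0 * g 1%nat). ring. }
split; [exact HS|].
replace ((q - 1) * q * (zeta s - 1) * (polylog s (1 / q) - / q))
  with ((q - 1) * q * zeta s * (polylog s (1 / q) - / q)
        - (q - 1) * q * (polylog s (1 / q) - / q)) by ring.
apply (is_Cseries_from_ext 2 (fun n : nat =>
  frakS (INR n) q / Cpower (INR n) s - (q - 1) * q * p n)).
- intros n Hn. unfold p, frakF. rewrite Cpower_opp_INR, Cpower_opp by exact Hq0.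
  unfold Cdiv. ring.
- apply (is_series_minus (V := C_NormedModule) _ _ _ _ HS).
  exact (is_series_scal_l (V := C_NormedModule) ((q - 1) * q) _ _ Hp).
Qed.
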